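(* Let $\lambda$ be an infinite cardinal and let $\mathcal{D}$ be a filter on the Boolean algebra $\mathfrak{B}$. Then the following are equivalent: (1) $\mathcal{D}$ is $\lambda^+$-good. (2) $\mathcal{D}$ is $\lambda^+$-excellent.
   Context: Filters are proper. $[\lambda]^{<\aleph_0}$ is the set of finite subsets of $\lambda$. Two elements $\mathbf a,\mathbf b$ of $\mathfrak{B}$ are equal mod $\mathcal{D}$ if they have the same image in $\mathfrak{B}/\mathcal{D}$. **Good.** $\mathcal{D}$ is $\lambda^+$-good if every $f:[\lambda]^{<\aleph_0}\to\mathcal{D}$ which is monotonic ($u\subseteq v\Rightarrow f(v)\le f(u)$) has a multiplicative refinement: some $g:[\lambda]^{<\aleph_0}\to\mathcal{D}$ with $g(u)\le f(u)$ and $g(u)\cap g(v)=g(u\cup v)$ for all $u,v$. **Excellent.** For finite $u$, consider Boolean terms $\sigma=\sigma(\langle x_v:v\subseteq u\rangle)$ (in the language with $\cap,\cup,\le,-,0,1$) in variables indexed by subsets of $u$. For a Boolean algebra $\mathfrak{A}$ and $\overline a=\langle a_v:v\subseteq u\rangle$ in $\mathfrak{A}$, let $N(\overline a)$ be the set of all sequences $\langle a'_v:v\subseteq u\rangle$ such that for some $w\subseteq u$, $a'_v=a_v$ if $v\subseteq w$ and $a'_v=0_{\mathfrak{A}}$ otherwise. Let $\Lambda_{\mathfrak{A},\overline a}$ be the set of Boolean terms $\sigma(\langle x_v:v\subseteq u\rangle)$ such that $\sigma(\overline a')=0$ in $\mathfrak{A}$ for every $\overline a'\in N(\overline a)$.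 $\mathcal{D}$ is $\lambda^+$-excellent if for every sequence $\langle\mathbf a_u:u\in[\lambda]^{<\aleph_0}\rangle$ of elements of $\mathfrak{B}$ there is a sequence $\langle\mathbf b_u:u\in[\lambda]^{<\aleph_0}\rangle$ of elements of $\mathfrak{B}$ such that for all $u\in[\lambda]^{<\aleph_0}$: $\mathbf b_u\le\mathbf a_u$; $\mathbf b_u=\mathbf a_u\bmod\mathcal{D}$; and for every $\sigma\in\Lambda_{\mathfrak{B}/\mathcal{D},\langle\mathbf a_v/\mathcal{D}:v\subseteq u\rangle}$, $\sigma(\langle\mathbf b_v:v\subseteq u\rangle)=0_{\mathfrak{B}}$.
   Formalization: In the definition of excellent, the terms in Λ are additionally required to vanish at the identically-0 sequence; taken literally, −x_∅ lies in Λ when a_∅/D = 1, so only D = {1} would be excellent, while every principal filter is good. *)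

(* Defs.v *)
From HB Require Import structures.
From mathcomp Require Import all_boot all_order finmap.
From mathcomp Require Import boolp classical_sets cardinality.

Set Implicit Arguments.
Unset Strict Implicit.
Unset Printing Implicit Defensive.

Import Order.Theory.
Local Open Scope order_scope.
Local Open Scope quotient_scope.

(* A Boolean algebra is a [ctbDistrLatticeType]. *)
Record bfilter (d : Order.disp_t) (B : ctbDistrLatticeType d) := BFilter {
  bfilter_set :> B -> Prop;
  bfilter_top : bfilter_set \top;
  bfilter_meet : forall x y, bfilter_set x -> bfilter_set y -> bfilter_set (x `&` y);
  bfilter_up : forall x y, x <= y -> bfilter_set x -> bfilter_set y;
  bfilter_proper : ~ bfilter_set \bot
}.

Section QuotientAlgebra.
Context (d : Order.disp_t) (B : ctbDistrLatticeType d) (D : bfilter B).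
Implicit Types x y z : B.

Definition beqmod : rel B := fun x y => `[< exists2 c, D c & x `&` c = y `&` c >].

Lemma beqmod_refl : reflexive beqmod.
Proof. by move=> x; apply/asboolP; exists \top => //; exact: bfilter_top. Qed.

Lemma beqmod_sym : symmetric beqmod.
Proof.
by move=> x y; apply/asboolP/asboolP => -[c Dc e]; exists c.
Qed.

Lemma beqmod_trans : transitive beqmod.
Proof.
move=> y x z /asboolP[c Dc xy] /asboolP[c' Dc' yz]; apply/asboolP.
exists (c `&` c'); first exact: bfilter_meet.
by rewrite meetA xy meetAC yz meetAC -meetA.
Qed.

Canonical beqmod_equiv := EquivRel beqmod beqmod_refl beqmod_sym beqmod_trans.

Definition bquot := {eq_quot beqmod}.

HB.instance Definition _ := Choice.on bquot.
HB.instance Definition _ := EqQuotient.on bquot.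

Lemma beqmodP x y :
  reflect (exists2 c, D c & x `&` c = y `&` c) (x == y %[mod bquot]).
Proof. by rewrite eqmodE; exact: asboolP. Qed.

Definition qbot : bquot := \pi_bquot \bot.
Definition qtop : bquot := \pi_bquot \top.
Definition qmeet (p q : bquot) : bquot := \pi_bquot (repr p `&` repr q).
Definition qjoin (p q : bquot) : bquot := \pi_bquot (repr p `|` repr q).
Definition qcompl (p : bquot) : bquot := \pi_bquot (~` repr p).
Definition qle : rel bquot := fun p q => qmeet p q == p.
Definition qlt : rel bquot := fun p q => (q != p) && qle p q.

Lemma repr_bquot x : exists2 c, D c & repr (\pi_bquot x) `&` c = x `&` c.
Proof. by apply/beqmodP; rewrite reprK. Qed.

Lemma pi_meet x y : \pi_bquot (x `&` y) = qmeet (\pi_bquot x) (\pi_bquot y).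
Proof.
apply/esym/eqP/beqmodP.
have [c Dc xc] := repr_bquot x; have [c' Dc' yc'] := repr_bquot y.
exists (c `&` c'); first exact: bfilter_meet.
by rewrite meetACA xc yc' meetACA.
Qed.

Lemma pi_join x y : \pi_bquot (x `|` y) = qjoin (\pi_bquot x) (\pi_bquot y).
Proof.
apply/esym/eqP/beqmodP.
have [c Dc xc] := repr_bquot x; have [c' Dc' yc'] := repr_bquot y.
exists (c `&` c'); first exact: bfilter_meet.
rewrite !meetUl; congr (_ `|` _); first by rewrite !meetA xc.
by rewrite !(meetC c) !meetA yc'.
Qed.

Lemma pi_compl x : \pi_bquot (~` x) = qcompl (\pi_bquot x).
Proof.
apply/esym/eqP/beqmodP; have [c Dc xc] := repr_bquot x; exists c => //.
have complIc y : ~` y `&` c = ~` (y `&` c) `&` c.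
  by rewrite complI meetUl [~` c `&` c]meetC meetxC joinx0.
by rewrite complIc xc -complIc.
Qed.

Lemma bquot_ind (P : bquot -> Prop) : (forall x, P (\pi_bquot x)) -> forall p, P p.
Proof. by move=> Ppi p; rewrite -[p]reprK. Qed.

Fact qle_def p q : qle p q = (qmeet p q == p). Proof. by []. Qed.
Fact qlt_def p q : qlt p q = (q != p) && qle p q. Proof. by []. Qed.
Fact qmeetC : commutative qmeet.
Proof. by move=> p q; rewrite /qmeet meetC. Qed.
Fact qjoinC : commutative qjoin.
Proof. by move=> p q; rewrite /qjoin joinC. Qed.
Fact qmeetA : associative qmeet.
Proof.
elim/bquot_ind=> x; elim/bquot_ind=> y; elim/bquot_ind=> z.
by rewrite -!pi_meet meetA.
Qed.
Fact qjoinA : associative qjoin.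
Proof.
elim/bquot_ind=> x; elim/bquot_ind=> y; elim/bquot_ind=> z.
by rewrite -!pi_join joinA.
Qed.
Fact qjoinKI q p : qmeet p (qjoin p q) = p.
Proof.
by elim/bquot_ind: p => x; elim/bquot_ind: q => y; rewrite -pi_join -pi_meet joinKI.
Qed.
Fact qmeetKU q p : qjoin p (qmeet p q) = p.
Proof.
by elim/bquot_ind: p => x; elim/bquot_ind: q => y; rewrite -pi_meet -pi_join meetKU.
Qed.
Fact qmeetUl : left_distributive qmeet qjoin.
Proof.
elim/bquot_ind=> x; elim/bquot_ind=> y; elim/bquot_ind=> z.
by rewrite -pi_join -!pi_meet -pi_join meetUl.
Qed.
Fact qmeetxx : idempotent_op qmeet.
Proof. by elim/bquot_ind=> x; rewrite -pi_meet meetxx. Qed.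

HB.instance Definition _ := Order.isMeetJoinDistrLattice.Build d bquot
  qle_def qlt_def qmeetC qjoinC qmeetA qjoinA qjoinKI qmeetKU qmeetUl qmeetxx.

Fact qle0x (p : bquot) : qbot <= p.
Proof. by elim/bquot_ind: p => x; rewrite leEmeet; apply/eqP; rewrite -[LHS]pi_meet meet0x. Qed.
Fact qlex1 (p : bquot) : p <= qtop.
Proof. by elim/bquot_ind: p => x; rewrite leEmeet; apply/eqP; rewrite -[LHS]pi_meet meetx1. Qed.

HB.instance Definition _ := Order.hasBottom.Build d bquot qle0x.
HB.instance Definition _ := Order.hasTop.Build d bquot qlex1.

Fact qjoinxC (p : bquot) : p `|` qcompl p = \top.
Proof. by elim/bquot_ind: p => x; rewrite -pi_compl -[LHS]pi_join joinxC. Qed.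
Fact qmeetxC (p : bquot) : p `&` qcompl p = \bot.
Proof. by elim/bquot_ind: p => x; rewrite -pi_compl -[LHS]pi_meet meetxC. Qed.

HB.instance Definition _ :=
  Order.TBDistrLattice_hasComplement.Build d bquot qjoinxC qmeetxC.

End QuotientAlgebra.

Inductive bterm (V : Type) : Type :=
| BVar of V
| BBot
| BTop
| BCompl of bterm V
| BMeet of bterm V & bterm V
| BJoin of bterm V & bterm V.

Fixpoint beval (V : Type) (d : Order.disp_t) (A : ctbDistrLatticeType d)
    (a : V -> A) (s : bterm V) : A :=
  match s with
  | BVar v => a v
  | BBot => \bot
  | BTop => \top
  | BCompl s1 => ~` beval a s1
  | BMeet s1 s2 => beval a s1 `&` beval a s2
  | BJoin s1 s2 => beval a s1 `|` beval a s2
  end.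

(* Infinite cardinals are represented by infinite types [L], so that
   [{fset L}] is the set of finite subsets of the cardinal. A sequence indexed
   by the subsets of [u] is a function on the finite type [fpowerset u]. *)

Section Excellence.
Context (L : choiceType).

Definition seqN (u : {fset L}) (d : Order.disp_t) (A : ctbDistrLatticeType d)
    (a : fpowerset u -> A) : set (fpowerset u -> A) :=
  [set a' | exists2 w : {fset L}, (w `<=` u)%fset &
     forall v : fpowerset u, a' v = if (val v `<=` w)%fset then a v else \bot].

(* The second clause asks that the term also vanish at the zero sequence. It
   must be stated separately because every sequence in [seqN a], the one for
   [w = fset0] included, keeps the entry of [a] at [fset0]. Without it, the term
   [BCompl (BVar fset0)] belongs to the set whenever the entry at [fset0] is
   [\top], so that no filter other than [{\top}] could be excellent: take for
   [a] in [excellent] a constant sequence in the filter, distinct from [\top]. *)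
Definition Lambda (u : {fset L}) (d : Order.disp_t) (A : ctbDistrLatticeType d)
    (a : fpowerset u -> A) : set (bterm (fpowerset u)) :=
  [set s | (forall a', seqN a a' -> beval a' s = \bot) /\
           beval (fun=> \bot : A) s = \bot].

Context (d : Order.disp_t) (B : ctbDistrLatticeType d) (D : bfilter B).

Definition good : Prop :=
  forall f : {fset L} -> B,
    (forall u, D (f u)) ->
    (forall u v, (u `<=` v)%fset -> f v <= f u) ->
    exists g : {fset L} -> B,
      [/\ forall u, D (g u),
          forall u, g u <= f u &
          forall u v, g u `&` g v = g (u `|` v)%fset].

Definition excellent : Prop :=
  forall a : {fset L} -> B,
    exists b : {fset L} -> B,
      forall u : {fset L},
        [/\ b u <= a u,
            b u = a u %[mod bquot D] &
            forall s : bterm (fpowerset u),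
              Lambda (fun v : fpowerset u => \pi_(bquot D) (a (val v))) s ->
              beval (fun v : fpowerset u => b (val v)) s = \bot].

End Excellence.

(* Main.v *)
From HB Require Import structures.
Require Import Defs.
From mathcomp Require Import all_boot all_order finmap.
From mathcomp Require Import boolp classical_sets cardinality.

(** Think of the elements of [B] as sets of points; a family [a] indexed by
    finite sets then gives at each point the set of indices [v] with the point
    in [a v].

    Good implies excellent.  For fixed [u] there are, up to equivalence, only
    finitely many terms over the subsets of [u], because the value of a term is
    a join of the [2 ^ 2 ^ #|u|] sign monomials.  Hence one element [c u] of [D]
    is disjoint from all term values in [a] that vanish modulo [D]
    ([null_terms_disjoint]).  The meet [f u] of the [c v], [v] a subset of [u],
    is antitone; let [g] be a multiplicative refinement of it and put
    [b u = a u `&` g u].  At any point, the subsets [v] of [u] with the point in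
    [g v] form an ideal closed under union, so they are either none, or exactly
    the subsets of their union [w].  In the first case [b] looks there like the
    zero sequence, in the second like [a] truncated to the subsets of [w]; that
    is, like one of the sequences at which terms in [Lambda] are required to
    vanish modulo [D].  As the point is then in [g w], which lies below [c w],
    these terms vanish there outright.  Points are replaced in the proof by the
    sign monomials of [g], whose join is [\top].

    Excellent implies good.  Apply excellence to the antitone family [f] itself.
    Modulo [D] all its entries are [\top], and for such a family the truncation
    to the subsets of [w] is the indicator of [v `<=` w].  Since [u] and [v] are
    subsets of [w] exactly when their union is, the terms
    [x_u `&` x_v `\` x_(u `|` v)] and [x_(u `|` v) `\` x_u] are in [Lambda], and
    their vanishing at [b] is the multiplicativity of [b]. *)

Set Implicit Arguments.
Unset Strict Implicit.
Unset Printing Implicit Defensive.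

Import Order.Theory.
Local Open Scope order_scope.
Local Open Scope quotient_scope.

(** * Evaluation of Boolean terms *)

Section Terms.
Context (d : Order.disp_t) (B : ctbDistrLatticeType d).
Implicit Types (x y c : B).

Lemma complIr x c : ~` x `&` c = ~` (x `&` c) `&` c.
Proof. by rewrite complI meetUl [~` c `&` c]meetC meetxC joinx0. Qed.

(** Relativization to [c] is a homomorphism onto the interval below [c]. *)
Lemma beval_relative V (a a' : V -> B) c (s : bterm V) :
  (forall v, a v `&` c = a' v `&` c) -> beval a s `&` c = beval a' s `&` c.
Proof.
move=> aa'; elim: s => //= [s IH|s IHs t IHt|s IHs t IHt].
- by rewrite complIr IH -complIr.
- by rewrite -[c in LHS]meetxx -[c in RHS]meetxx meetACA IHs IHt meetACA.
- by rewrite !meetUl IHs IHt.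
Qed.

Fixpoint bsubst V W (t : V -> bterm W) (s : bterm V) : bterm W :=
  match s with
  | BVar v => t v
  | BBot => BBot W
  | BTop => BTop W
  | BCompl s1 => BCompl (bsubst t s1)
  | BMeet s1 s2 => BMeet (bsubst t s1) (bsubst t s2)
  | BJoin s1 s2 => BJoin (bsubst t s1) (bsubst t s2)
  end.

Lemma beval_subst V W (a : W -> B) (t : V -> bterm W) s :
  beval a (bsubst t s) = beval (fun v => beval a (t v)) s.
Proof. by elim: s => //= [s ->|s -> t' ->|s -> t' ->]. Qed.

Definition bconst (k : bool) : B := if k then \top else \bot.

Lemma beval_const V (e : V -> bool) (s : bterm V) :
  beval (fun v => bconst (e v)) s = bconst (beval e s).
Proof.
elim: s => //= [s ->|s -> t ->|s -> t ->]; rewrite /bconst.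
- by case: (beval e s); rewrite /= ?compl0 ?compl1.
- by case: (beval e s); rewrite /= ?meet1x ?meet0x.
- by case: (beval e s); rewrite /= ?join1x ?join0x.
Qed.

(** * Sign monomials *)

(** Lets [big_distrr] and [bigA_distr_bigA] apply to [\meet] of [\join]. *)
HB.instance Definition _ :=
  Monoid.isAddLaw.Build B Order.meet Order.join meetUl meetUr.

Section Monomials.
Context (V : finType) (a : V -> B).

Definition bmonomial (e : {ffun V -> bool}) : B :=
  \meet_(v : V) (if e v then a v else ~` a v).

Lemma meet_bmonomial e v : a v `&` bmonomial e = bconst (e v) `&` bmonomial e.
Proof.
have : bmonomial e <= (if e v then a v else ~` a v) by exact: meets_inf.
rewrite /bconst; case: (e v) => le_m; first by rewrite meet1x; apply/meet_idPr.
by rewrite meet0x; apply/eqP; rewrite meetC disj_leC.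
Qed.

Lemma join_bmonomial : \join_(e : {ffun V -> bool}) bmonomial e = \top.
Proof.
transitivity (\meet_(v : V) \join_(k : bool) (if k then a v else ~` a v)).
  by rewrite bigA_distr_bigA.
by apply: big1 => v _; rewrite big_bool /= joinxC.
Qed.

(** The algebraic form of arguing pointwise. *)
Lemma eq_bot_on_bmonomials x : (forall e, x `&` bmonomial e = \bot) -> x = \bot.
Proof.
move=> x0; rewrite -[x]meetx1 -join_bmonomial big_distrr /=.
by apply: big1 => e _; exact: x0.
Qed.

Lemma beval_bmonomial (s : bterm V) e :
  beval a s `&` bmonomial e = bconst (beval e s) `&` bmonomial e.
Proof.
by rewrite -beval_const; apply: beval_relative => v; exact: meet_bmonomial.
Qed.

End Monomials.
End Terms.

(** * Terms that vanish modulo a filter *)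

Section Filter.
Context (d : Order.disp_t) (B : ctbDistrLatticeType d) (D : bfilter B).

Lemma bfilter_meets I (r : seq I) (P : pred I) (F : I -> B) :
  (forall i, P i -> D (F i)) -> D (\meet_(i <- r | P i) F i).
Proof.
by move=> DF; apply: big_ind => //; [exact: bfilter_top | exact: bfilter_meet].
Qed.

Lemma pi_eq_bot (x : B) : (\pi_(bquot D) x = \bot) <-> D (~` x).
Proof.
split=> [/eqP/beqmodP[c Dc]|Dx].
  rewrite meet0x => /eqP; rewrite meetC disj_leC => cx.
  exact: bfilter_up cx Dc.
by apply/eqP/beqmodP; exists (~` x); rewrite // meetxC meet0x.
Qed.

Lemma pi_eq_top (x : B) : (\pi_(bquot D) x = \top) <-> D x.
Proof.
split=> [/eqP/beqmodP[c Dc]|Dx].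
  by rewrite meet1x => /meet_idPr cx; exact: bfilter_up cx Dc.
by apply/eqP/beqmodP; exists x; rewrite // meetxx meet1x.
Qed.

Lemma beval_pi V (a : V -> B) (s : bterm V) :
  beval (fun v => \pi_(bquot D) (a v)) s = \pi_(bquot D) (beval a s).
Proof.
elim: s => //= [s ->|s -> t ->|s -> t ->].
- by rewrite pi_compl.
- by rewrite pi_meet.
- by rewrite pi_join.
Qed.

(** There are infinitely many terms, but each value is a join of some of the
    finitely many monomials, which all are null if the value is; so it is
    enough to avoid the null monomials. *)
Lemma null_terms_disjoint (V : finType) (a : V -> B) :
  exists2 c, D c & forall s, D (~` beval a s) -> beval a s `&` c = \bot.
Proof.
pose null e := `[< D (~` bmonomial a e) >].
exists (\meet_(e | null e) ~` bmonomial a e).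
  by apply: bfilter_meets => e /asboolP.
move=> s Ds; apply: (eq_bot_on_bmonomials (a := a)) => e.
rewrite meetAC beval_bmonomial.
have := beval_bmonomial a s e.
case: (beval e s); rewrite /bconst; last by rewrite !meet0x.
rewrite !meet1x => /meet_idPr le_m.
have null_e : null e by apply/asboolP; apply: bfilter_up Ds; rewrite leC.
apply/eqP; rewrite -lex0 -(meetxC (bmonomial a e)) leI2 //.
exact: meets_inf.
Qed.

(** At the zero sequence a term is a constant, so properness suffices here. *)
Lemma beval_bot_null V (s : bterm V) :
  D (~` beval (fun=> \bot : B) s) -> beval (fun=> \bot : B) s = \bot.
Proof.
rewrite (beval_const B (fun=> false) s) /bconst.
by case: (beval _ s) => //; rewrite compl1 => /bfilter_proper.
Qed.

End Filter.

(** * Good and excellent filters *)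

Section Families.
Context (L : choiceType) (d : Order.disp_t) (B : ctbDistrLatticeType d).
Implicit Types (u v w : {fset L}) (a g : {fset L} -> B).

Lemma multiplicative_antitone g :
  (forall u v, g u `&` g v = g (u `|` v)%fset) ->
  forall u v, (u `<=` v)%fset -> g v <= g u.
Proof. by move=> gM u v /fsetUidPr uv; apply/meet_idPr; rewrite gM uv. Qed.

(** The index [i0] bounds [m] when the union is empty: [g (F i0) <= g fset0]. *)
Lemma multiplicative_bigcup g (gM : forall u v, g u `&` g v = g (u `|` v)%fset)
    (I : eqType) (r : seq I) (P : pred I) (F : I -> {fset L}) (m : B) (i0 : I) :
  P i0 -> (forall i, P i -> m <= g (F i)) ->
  m <= g (\bigcup_(i <- r | P i) F i)%fset.
Proof.
move=> Pi0 mF; apply: (big_ind (fun w => m <= g w)) => // [|u v mu mv].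
  apply: le_trans (mF _ Pi0) _.
  exact: multiplicative_antitone gM _ _ (fsub0set _).
by rewrite -gM lexI mu.
Qed.

Definition truncate a u w (v : fpowerset u) : B :=
  if (val v `<=` w)%fset then a (val v) else \bot.

(** Substituting [0] for the variables cut off by the truncation to [w] leaves
    a term over the subsets of [w] alone.  So the element of [D] chosen for [w]
    takes care of that truncation for every [u] containing [w] at once. *)
Definition restrict_term u w (s : bterm (fpowerset u)) : bterm (fpowerset w) :=
  bsubst (fun v : fpowerset u =>
    if insub (val v) is Some v' then BVar (v' : fpowerset w)
    else BBot (fpowerset w)) s.

Lemma beval_restrict_term a u w (s : bterm (fpowerset u)) :
  beval (fun v : fpowerset w => a (val v)) (restrict_term w s) =
  beval (truncate a w (u := u)) s.
Proof.
rewrite beval_subst; congr (beval _ s); apply/funext => v; rewrite /truncate.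
by case: insubP => [v' + /= ->|]; rewrite fpowersetE; [move=> -> | move/negPf ->].
Qed.

(** If the monomial lies below [g v] and [g v'], it lies below [g (v `|` v')],
    and below [g] at any smaller set; so its positive signs form an ideal, which
    is principal, [u] being finite. *)
Lemma bmonomial_ideal g (gM : forall u v, g u `&` g v = g (u `|` v)%fset)
    u (e : {ffun fpowerset u -> bool}) :
  let m := bmonomial (fun v : fpowerset u => g (val v)) e in
  (forall v : fpowerset u, g (val v) `&` m = \bot) \/
  exists w, [/\ (w `<=` u)%fset, m <= g w &
    forall v : fpowerset u,
      g (val v) `&` m = if (val v `<=` w)%fset then m else \bot].
Proof.
move=> m.
have gm (v : fpowerset u) : g (val v) `&` m = bconst B (e v) `&` m.
  exact: (meet_bmonomial (fun v : fpowerset u => g (val v)) e v).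
case: (pickP e) => [v0 ev0|e0]; last by left=> v; rewrite gm e0 meet0x.
pose w := (\bigcup_(v <- index_enum (fpowerset u) | e v) val v)%fset.
have mw : m <= g w.
  apply: (multiplicative_bigcup gM) ev0 _ => v ev.
  by apply/meet_idPr; rewrite gm ev meet1x.
right; exists w; split=> // [|v].
  by apply/bigfcupsP => v _ _; rewrite -fpowersetE; exact: valP.
case: ifPn => [vw|]; last first.
  rewrite gm; case ev: (e v); last by rewrite meet0x.
  by case/negP; apply: bigfcup_sup => //; exact: mem_index_enum.
apply/meet_idPr; apply: le_trans mw _; exact: multiplicative_antitone gM _ _ vw.
Qed.

Context (D : bfilter B).

Lemma Lambda_truncate a u w (s : bterm (fpowerset u)) :
  (w `<=` u)%fset ->
  Lambda (fun v : fpowerset u => \pi_(bquot D) (a (val v))) s ->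
  D (~` beval (truncate a w (u := u)) s).
Proof.
move=> wu [sN _]; apply/pi_eq_bot; rewrite -beval_pi; apply: sN.
by exists w => // v; rewrite /truncate; case: ifP.
Qed.

Lemma good_excellent : good L D -> excellent L D.
Proof.
move=> Dgood a.
have /choice[c cP] w : exists c, D c /\
    forall s, D (~` beval (fun v : fpowerset w => a (val v)) s) ->
      beval (fun v : fpowerset w => a (val v)) s `&` c = \bot.
  by have [c] := null_terms_disjoint D (fun v : fpowerset w => a (val v)); exists c.
(* The [c w] are chosen independently; taking meets makes them antitone. *)
pose f u := \meet_(v : fpowerset u) c (val v).
have f_le_c u : f u <= c u.
  have uu : u \in fpowerset u by rewrite fpowersetE.
  exact: (meets_inf (j := [` uu]%fset)).
have Df u : D (f u) by apply: bfilter_meets => v _; have [] := cP (val v).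
have f_anti u v : (u `<=` v)%fset -> f v <= f u.
  move=> uv; apply/meetsP => -[w /= wu] _.
  have wv : w \in fpowerset v.
    by move: wu; rewrite !fpowersetE => /fsubset_trans; apply.
  exact: (meets_inf (j := [` wv]%fset)).
have [g [Dg gf gM]] := Dgood f Df f_anti.
exists (fun u => a u `&` g u) => u; split; first exact: leIl.
  by apply/eqP/beqmodP; exists (g u); rewrite // -meetA meetxx.
move=> s sL; apply: (eq_bot_on_bmonomials (a := fun v : fpowerset u => g (val v))).
move=> e; set m := bmonomial _ e.
have [g0|[w [wu mw gw]]] := bmonomial_ideal gM e.
  rewrite (@beval_relative _ _ _ _ (fun=> \bot)); last first.
    by move=> v; rewrite -meetA g0 meetx0 meet0x.
  rewrite (beval_bot_null (D := D)) ?meet0x //.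
  by apply/pi_eq_bot; rewrite -beval_pi; case: sL.
rewrite (@beval_relative _ _ _ _ (truncate a w (u := u))); last first.
  by move=> v; rewrite -meetA gw /truncate; case: ifP; rewrite // meetx0 meet0x.
have [_ cw] := cP w; have := cw (restrict_term w s).
rewrite beval_restrict_term => /(_ (Lambda_truncate wu sL)) s0.
apply/eqP; rewrite -lex0 -s0 leI2 //.
exact: le_trans mw (le_trans (gf w) (f_le_c w)).
Qed.

Lemma excellent_good : excellent L D -> good L D.
Proof.
move=> Dexc f Df f_anti; have [b bP] := Dexc f; exists b.
have Db u : D (b u).
  have [_ bf _] := bP u; apply/pi_eq_top; rewrite bf; exact/pi_eq_top.
split=> // [u|u v]; first by have [] := bP u.
have [_ _ bL] := bP (u `|` v)%fset.
have fT w : \pi_(bquot D) (f w) = \top by exact/pi_eq_top.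
have uP : u \in fpowerset (u `|` v)%fset by rewrite fpowersetE fsubsetUl.
have vP : v \in fpowerset (u `|` v)%fset by rewrite fpowersetE fsubsetUr.
have uvP : (u `|` v)%fset \in fpowerset (u `|` v)%fset by rewrite fpowersetE.
pose xu := BVar [` uP]%fset; pose xv := BVar [` vP]%fset.
pose xuv := BVar [` uvP]%fset.
(* Membership in [Lambda] is a finite check, on the truth values at [w] of
   [u `<=` w] and [v `<=` w]. *)
have in_Lambda s : s = BMeet (BMeet xu xv) (BCompl xuv) \/
    s = BMeet xuv (BCompl xu) \/ s = BMeet xuv (BCompl xv) ->
    Lambda (fun x : fpowerset (u `|` v)%fset => \pi_(bquot D) (f (val x))) s.
  move=> sE; split=> [a' [w _ a'E]|]; last first.
    by case: sE => [|[]] ->; rewrite /= ?meet0x.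
  case: sE => [|[]] -> /=; rewrite !a'E /= !fT fsubUset;
    case: (u `<=` w)%fset; case: (v `<=` w)%fset => /=;
    by rewrite ?compl1 ?meetx0 ?meet0x.
have le_of_bot (x y : B) : x `&` ~` y = \bot -> x <= y.
  by move/eqP; rewrite disj_leC complK.
apply/eqP; rewrite eq_le lexI; apply/and3P; split; apply: le_of_bot.
- by apply: bL (BMeet (BMeet xu xv) (BCompl xuv)) _; apply: in_Lambda; left.
- by apply: bL (BMeet xuv (BCompl xu)) _; apply: in_Lambda; right; left.
- by apply: bL (BMeet xuv (BCompl xv)) _; apply: in_Lambda; right; right.
Qed.

End Families.

Theorem theorem12p3 (L : choiceType) (infL : infinite_set [set: L]%classic)
    (d : Order.disp_t) (B : ctbDistrLatticeType d) (D : bfilter B) :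
  good L D <-> excellent L D.
Proof. by split; [exact: good_excellent | exact: excellent_good]. Qed.
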